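(* Let $(G,c)$ be an electrical network with vertex set $V$ and fixed base vertex $o\in V$. Let $T$ be the operator from $\ell^2(V)$ to $\mathcal H_E$ with domain $\mathrm{span}\{\delta_x : x\in V\}$ given by $T\delta_x=\delta_x$, and let $S$ be the operator from $\mathcal H_E$ to $\ell^2(V)$ with domain $\mathrm{span}\{v_x : x\in V\}$ given by $S v_x=\delta_x-\delta_o$, where $v_x$ are the dipoles. Denote by $\overline T,\overline S$ the closures and by $T^*, S^*$ the adjoints. Then $T^*\overline T$ is a self-adjoint extension of $\Delta_2$, and $S^*\overline S$ is a self-adjoint extension of $\Delta_{\mathcal H_E}$.
   Context: An electrical network $(G,c)$ is a countably infinite, connected, undirected, locally finite graph $G=(V,E)$ without loops and with single edges, together with a symmetric conductance function $c:V\times V\to[0,\infty)$, $c_{xy}=c_{yx}$, with $c_{xy}>0$ if and only if $(xy)\in E$ (written $x\sim y$). Functions are real-valued. The Laplacian is $(\Delta f)(x)=\sum_{y\sim x}c_{xy}(f(x)-f(y))$. The space $\ell^2(V)$ has inner product $\sum_{x}u(x)v(x)$. The energy form is $\mathcal E(u,v)=\frac12\sum_{x,y\in V}c_{xy}(u(x)-u(y))(v(x)-v(y))$, and the finite energy Hilbert space $\mathcal H_E$ is the space of functions $u$ with $\mathcal E(u,u)<\infty$ modulo constants (completed), with inner product $\langle u,v\rangle_{\mathcal H_E}=\mathcal E(u,v)$. $\delta_x$ is the Kronecker delta function at $x$ (it has finite energy, so it is also regarded as an element of $\mathcal H_E$). For a fixed vertex $o$, the dipole $v_x\in\mathcal H_E$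 is the unique element with $\langle v_x,u\rangle_{\mathcal H_E}=u(x)-u(o)$ for all $u\in\mathcal H_E$; one has $\Delta v_x=\delta_x-\delta_o$, and $\mathrm{span}\{v_x\}$ is dense in $\mathcal H_E$. $\Delta_2$ is the closure in $\ell^2(V)$ of $\Delta$ with domain $\mathrm{span}\{\delta_x:x\in V\}$ (finite linear combinations). $\Delta_{\mathcal H_E}$ is the closure in $\mathcal H_E$ of $\Delta$ with domain $\mathrm{span}\{v_x:x\in V\}$. *)

(* Defs.v *)
From HB Require Import structures.
From mathcomp Require Import all_boot all_order all_algebra.
From mathcomp Require Import all_classical all_reals all_analysis.
From mathcomp Require Import ring lra.

Set Implicit Arguments.
Unset Strict Implicit.
Unset Printing Implicit Defensive.

Import Order.TTheory GRing.Theory Num.Theory.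
Import numFieldNormedType.Exports.
Local Open Scope classical_set_scope.
Local Open Scope ring_scope.

(* Sum of an unordered family of reals, meaningful when the family is
   absolutely summable. *)
Definition rsum (R : realType) (I : choiceType) (f : I -> R) : R :=
  fine (\esum_(i in [set: I]) (EFin \o f)^\+ i -
        \esum_(i in [set: I]) (EFin \o f)^\- i)%E.

Section RealSums.
Context {R : realType} {I : choiceType}.
Implicit Types (f g : I -> R).

Let sm f := summable [set: I] (EFin \o f).
Let es f := (\esum_(i in [set: I]) (f i)%:E)%E.

Let ge0_summable f : (forall i, 0 <= f i) -> sm f = (es f < +oo)%E.
Proof.
move=> f0; rewrite /sm /summable /es; congr (_ < _)%E.
by apply: eq_esum => i _ /=; rewrite ger0_norm.
Qed.

Lemma rsum_ge0E f : (forall i, 0 <= f i) -> rsum f = fine (es f).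
Proof.
move=> f0; rewrite /rsum /es; congr fine.
rewrite [X in (_ - X)%E]esum1 ?sube0.
  by apply: eq_esum => i _; rewrite funeposE/=; apply/max_idPl; rewrite lee_fin.
by move=> i _; rewrite funenegE/=; apply/max_idPr; rewrite lee_fin oppr_le0.
Qed.

Lemma rsumB f g : (forall i, 0 <= f i) -> (forall i, 0 <= g i) ->
  sm f -> sm g -> rsum (f \- g) = rsum f - rsum g.
Proof.
move=> f0 g0 sf sg; rewrite (rsum_ge0E f0) (rsum_ge0E g0) /rsum.
have -> : EFin \o (f \- g) = ((EFin \o f) \- (EFin \o g))%E by apply/funext.
rewrite esumB//= ; try by move=> i _ /=; rewrite lee_fin.
rewrite fineB// fin_numElt (lt_le_trans (ltNyr 0)) ?esum_ge0//=.
- by rewrite -[ltLHS]/(es f) -ge0_summable.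
- by move=> i _; rewrite lee_fin.
- by rewrite -[ltLHS]/(es g) -ge0_summable.
- by move=> i _; rewrite lee_fin.
Qed.

Lemma summable_le f g : sm g -> (forall i, `|f i| <= `|g i|) -> sm f.
Proof.
move=> sg fg; apply: le_lt_trans sg; apply: le_esum => i _ /=.
by rewrite lee_fin.
Qed.

Lemma summableZ f k : sm f -> sm (fun i => k * f i).
Proof.
move=> sf; have [k0|k0] := eqVneq k 0.
  rewrite /sm /summable esum1 ?ltry// => i _ /=.
  by rewrite k0 mul0r normr0.
rewrite /sm /summable; apply: (@le_lt_trans _ _
   (`|k|%:E * \esum_(i in setT) `|(f i)%:E|)%E); last first.
  by rewrite lte_mul_pinfty.
apply: ge_ereal_sup => /= _ [X [fX _]] <-.
under eq_fsbigr do rewrite normrM EFinM.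
rewrite -ge0_mule_fsumr// lee_pmul2l// ?lte_fin ?normr_gt0//.
by apply: ereal_sup_ubound; exists X.
Qed.

Lemma rsumD f g : sm f -> sm g -> rsum (f \+ g) = rsum f + rsum g.
Proof.
pose p (h : I -> R) i := Num.max (h i) 0; pose n (h : I -> R) i := Num.max (- h i) 0.
have p0 h i : 0 <= p h i by rewrite le_max lexx orbT.
have n0 h i : 0 <= n h i by rewrite le_max lexx orbT.
have sp h : sm h -> sm (p h).
  move=> sh; apply: summable_le sh _ => i; rewrite (ger0_norm (p0 _ _)).
  by rewrite /p ge_max ler_norm normr_ge0.
have sn h : sm h -> sm (n h).
  move=> sh; apply: summable_le sh _ => i; rewrite (ger0_norm (n0 _ _)).
  by rewrite /n ge_max -normrN ler_norm normr_ge0.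
have pn h : h = p h \- n h.
  apply/funext => i; rewrite /p/n /=.
  by case: (leP (h i) 0) => hi; case: (leP (- h i) 0); lra.
have sD h k : sm h -> sm k -> sm (h \+ k) by exact: summableD.
have eD h k : (forall i, 0 <= h i) -> (forall i, 0 <= k i) -> sm h -> sm k ->
    rsum (h \+ k) = rsum h + rsum k.
  move=> h0 k0 sh sk; rewrite !rsum_ge0E// => [|i]; last by rewrite addr_ge0.
  rewrite /es; under eq_esum do rewrite EFinD.
  rewrite esumD//; try by move=> i _ /=; rewrite lee_fin.
  rewrite fineD// fin_numElt (lt_le_trans (ltNyr 0)) ?esum_ge0//=.
  - by rewrite -[ltLHS]/(es h) -ge0_summable.
  - by move=> i _; rewrite lee_fin.
  - by rewrite -[ltLHS]/(es k) -ge0_summable.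
  - by move=> i _; rewrite lee_fin.
move=> sf sg.
have e : f \+ g = (p f \+ p g) \- (n f \+ n g).
  apply/funext => i; rewrite [in LHS](pn f) [in LHS](pn g) /=; ring.
rewrite e rsumB; first last.
- by apply: sD; exact: sn.
- by apply: sD; exact: sp.
- by move=> i; rewrite addr_ge0.
- by move=> i; rewrite addr_ge0.
rewrite (eD _ _ (p0 f) (p0 g) (sp _ sf) (sp _ sg)).
rewrite (eD _ _ (n0 f) (n0 g) (sn _ sf) (sn _ sg)).
rewrite [in RHS](pn f) [in RHS](pn g) (rsumB (p0 f) (n0 f) (sp _ sf) (sn _ sf)).
by rewrite (rsumB (p0 g) (n0 g) (sp _ sg) (sn _ sg)); ring.
Qed.

Lemma rsum0 : rsum (fun _ : I => 0 : R) = 0.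
Proof. by rewrite rsum_ge0E// /es esum1. Qed.

Lemma rsumN f : sm f -> rsum (fun i => - f i) = - rsum f.
Proof.
move=> sf; apply/eqP; rewrite -addr_eq0 -rsumD//.
  by rewrite -[eqbRHS]rsum0; apply/eqP; congr rsum; apply/funext => i /=; rewrite addNr.
by apply: summable_le sf _ => i; rewrite normrN.
Qed.

Lemma rsumZ f k : sm f -> rsum (fun i => k * f i) = k * rsum f.
Proof.
have ge0Z h c : 0 <= c -> (forall i, 0 <= h i) -> sm h ->
    rsum (fun i => c * h i) = c * rsum h.
  move=> c0 h0 sh; have [->|cN0] := eqVneq c 0.
    by rewrite mul0r -[RHS]rsum0; congr rsum; apply/funext => i; rewrite mul0r.
  have cp : 0 < c by rewrite lt_neqAle eq_sym cN0.
  rewrite !rsum_ge0E// => [|i]; last by rewrite mulr_ge0.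
  have -> : es (fun i => c * h i) = (c%:E * es h)%E; last first.
    rewrite fineM// fin_numElt (lt_le_trans (ltNyr 0)) ?esum_ge0//=.
      by rewrite -ge0_summable.
    by move=> i _; rewrite lee_fin.
  have leZ d g : 0 < d -> (forall i, 0 <= g i) ->
      (es (fun i => d * g i)%R <= d%:E * es g)%E.
    move=> dp g0; apply: ge_ereal_sup => /= _ [X [fX _]] <-.
    under eq_fsbigr do rewrite EFinM.
    rewrite -ge0_mule_fsumr//.
    rewrite lee_pmul2l// ?lte_fin//.
    by apply: ereal_sup_ubound; exists X.
  apply/eqP; rewrite eq_le leZ//=.
  have := @leZ c^-1 (fun i => c * h i); rewrite invr_gt0 => /(_ cp).
  move=> /(_ (fun i => mulr_ge0 c0 (h0 i))).
  rewrite -(@lee_pmul2l _ c%:E) ?lte_fin// muleA -EFinM divff// mul1e.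
  by under [es (fun _ => c^-1 * _)]eq_esum do rewrite mulrA mulVf// mul1r.
have ge0Zr h c : (forall i, 0 <= h i) -> sm h ->
    rsum (fun i => c * h i) = c * rsum h.
  move=> h0 sh; case: (leP 0 c) => c0; first exact: ge0Z.
  rewrite (_ : (fun i => c * h i) = (fun i => - (- c * h i))).
    rewrite rsumN ?ge0Z ?oppr_ge0 ?ltW//; first by rewrite mulNr opprK.
    exact: summableZ.
  by apply/funext => i; rewrite mulNr opprK.
move=> sf.
pose p i := Num.max (f i) 0; pose n i := Num.max (- f i) 0.
have p0 i : 0 <= p i by rewrite le_max lexx orbT.
have n0 i : 0 <= n i by rewrite le_max lexx orbT.
have sp : sm p.
  apply: summable_le sf _ => i; rewrite (ger0_norm (p0 _)).
  by rewrite /p ge_max ler_norm normr_ge0.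
have sn : sm n.
  apply: summable_le sf _ => i; rewrite (ger0_norm (n0 _)).
  by rewrite /n ge_max -normrN ler_norm normr_ge0.
have pn : f = p \- n.
  apply/funext => i; rewrite /p/n /=.
  by case: (leP (f i) 0) => hi; case: (leP (- f i) 0); lra.
have -> : (fun i => k * f i) = (fun i => k * p i) \+ (fun i => (- k) * n i).
  by apply/funext => i; rewrite [in LHS]pn /=; ring.
rewrite rsumD ?ge0Zr//; do ?exact: summableZ.
by rewrite [in RHS]pn rsumB//; ring.
Qed.

End RealSums.

HB.mixin Record NormedModule_hasInner (R : realType) H of NormedModule R H := {
  inner : H -> H -> R;
  innerC : forall x y, inner x y = inner y x;
  innerDl : forall x y z, inner (x + y) z = inner x z + inner y z;
  innerZl : forall a x y, inner (a *: x) y = a * inner x y;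
  inner_norm : forall x, inner x x = `|x| ^+ 2
}.

#[short(type="preHilbertType")]
HB.structure Definition PreHilbert (R : realType) :=
  {H of NormedModule R H & NormedModule_hasInner R H}.

#[short(type="hilbertType")]
HB.structure Definition Hilbert (R : realType) :=
  {H of PreHilbert R H & CompleteNormedModule R H}.

HB.factory Record Lmodule_hasInner (R : realType) H of GRing.Lmodule R H := {
  dotf : H -> H -> R;
  dotfC : forall x y, dotf x y = dotf y x;
  dotfDl : forall x y z, dotf (x + y) z = dotf x z + dotf y z;
  dotfZl : forall a x y, dotf (a *: x) y = a * dotf x y;
  dotf_ge0 : forall x, 0 <= dotf x x;
  dotf_eq0 : forall x, dotf x x = 0 -> x = 0
}.

HB.builders Context (R : realType) H of Lmodule_hasInner R H.

Let dotfDr x y z : dotf z (x + y) = dotf z x + dotf z y.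
Proof. by rewrite dotfC dotfDl !(dotfC z). Qed.

Let dotfZr a x y : dotf y (a *: x) = a * dotf y x.
Proof. by rewrite dotfC dotfZl (dotfC y). Qed.

Let CauchySchwarz x y : dotf x y ^+ 2 <= dotf x x * dotf y y.
Proof.
have [y0|yN0] := eqVneq (dotf y y) 0.
  by rewrite (dotf_eq0 y0) -(scale0r 0) !dotfZr !mul0r mulr0 expr0n.
have yp : 0 < dotf y y by rewrite lt_neqAle eq_sym yN0 dotf_ge0.
have := dotf_ge0 (dotf y y *: x + (- dotf x y) *: y).
rewrite !(dotfDl, dotfDr, dotfZl, dotfZr) (dotfC y x) => h.
rewrite -subr_ge0 -(pmulr_rge0 _ yp); apply: le_trans h _.
by rewrite le_eqVlt; apply/orP; left; apply/eqP; ring.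
Qed.

Let norm x := Num.sqrt (dotf x x).

Let norm_triangle x y : norm (x + y) <= norm x + norm y.
Proof.
rewrite /norm -(@ler_pXn2r _ 2) ?nnegrE ?addr_ge0 ?sqrtr_ge0//.
rewrite sqr_sqrtr ?dotf_ge0// sqrrD !sqr_sqrtr ?dotf_ge0//.
rewrite !(dotfDl, dotfDr) (dotfC y x).
suff : dotf x y <= Num.sqrt (dotf x x) * Num.sqrt (dotf y y) by lra.
rewrite -sqrtrM ?dotf_ge0//; apply: le_trans (ler_norm _) _.
by rewrite -sqrtr_sqr ler_wsqrtr.
Qed.

Let normZ a x : norm (a *: x) = `|a| * norm x.
Proof. by rewrite /norm dotfZl dotfZr mulrA -expr2 sqrtrM ?sqr_ge0// sqrtr_sqr. Qed.

Let norm_eq0 x : norm x = 0 -> x = 0.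
Proof.
move=> /eqP; rewrite sqrtr_eq0 => h; apply: dotf_eq0.
by apply/eqP; rewrite eq_le h dotf_ge0.
Qed.

HB.instance Definition _ := Lmodule_isNormed.Build R H norm_triangle normZ norm_eq0.

Let dotf_norm x : dotf x x = `|x| ^+ 2.
Proof. by rewrite -[`|x|]/(norm x) sqr_sqrtr ?dotf_ge0. Qed.

HB.instance Definition _ :=
  NormedModule_hasInner.Build R H dotfC dotfDl dotfZl dotf_norm.

HB.end.

Section HilbertTheory.
Context {R : realType} {H : preHilbertType R}.
Implicit Types x y : H.
Lemma norm_inner x : `|x| = Num.sqrt (inner x x).
Proof. by rewrite inner_norm sqrtr_sqr normr_id. Qed.
End HilbertTheory.

Definition square_summable (R : realType) (I : choiceType) : {pred I -> R} :=
  fun f => (\esum_(i in [set: I]) (f i ^+ 2)%:E < +oo)%E.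

Section L2.
Context (R : realType) (I : choiceType).

Record l2 := L2 { l2fun :> I -> R; l2funP : l2fun \in @square_summable R I }.

HB.instance Definition _ := [isSub for l2fun].
HB.instance Definition _ := [Choice of l2 by <:].

Lemma summable_sq (f : I -> R) :
  (f \in @square_summable R I) = summable setT (EFin \o (fun i => f i ^+ 2)).
Proof.
rewrite unfold_in /square_summable /summable; congr (_ < _)%E.
by apply: eq_esum => i _ /=; rewrite ger0_norm ?sqr_ge0.
Qed.

Lemma summable_mul (f g : I -> R) : f \in @square_summable R I ->
  g \in @square_summable R I -> summable setT (EFin \o (fun i => f i * g i)).
Proof.
rewrite !summable_sq => sf sg.
have sD : summable [set: I] (EFin \o (fun i => f i ^+ 2 + g i ^+ 2)).
  exact: summableD sf sg.
apply: (summable_le sD) => i; rewrite [leRHS]ger0_norm ?addr_ge0 ?sqr_ge0//.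
rewrite ler_norml -[X in _ && X]subr_ge0 -subr_ge0; apply/andP; split; last first.
  have := sqr_ge0 (f i - g i); have := sqr_ge0 (f i); have := sqr_ge0 (g i); lra.
have := sqr_ge0 (f i + g i); have := sqr_ge0 (f i); have := sqr_ge0 (g i); lra.
Qed.

Lemma square_summable_submod : submod_closed (@square_summable R I).
Proof.
split.
  rewrite summable_sq /summable esum1 ?ltry// => i _ /=.
  by rewrite expr0n/= normr0.
move=> a f g sf sg; have sfg := summable_mul sf sg; move: sf sg.
rewrite !summable_sq => sf sg.
have := summableD (summableZ (a ^+ 2) sf)
  (summableD (summableZ (2 * a) sfg) sg).
apply: le_lt_trans; rewrite le_eqVlt; apply/orP; left; apply/eqP.
apply: eq_esum => i _ /=; congr (`|_|%:E).
by rewrite -[(a *: f + g) i]/(a * f i + g i); ring.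
Qed.
HB.instance Definition _ := GRing.isSubmodClosed.Build R (I -> R)
  (@square_summable R I) square_summable_submod.
HB.instance Definition _ := [SubChoice_isSubLmodule of l2 by <:].

Definition l2_inner (u v : l2) : R := rsum (fun i => u i * v i).

Fact l2_innerC u v : l2_inner u v = l2_inner v u.
Proof. by congr rsum; apply/funext => i; rewrite mulrC. Qed.

Fact l2_innerDl u v w : l2_inner (u + v) w = l2_inner u w + l2_inner v w.
Proof.
rewrite -rsumD; do ?by apply: summable_mul; exact: l2funP.
by congr rsum; apply/funext => i; exact: mulrDl.
Qed.

Fact l2_innerZl a u v : l2_inner (a *: u) v = a * l2_inner u v.
Proof.
rewrite -rsumZ; last by apply: summable_mul; exact: l2funP.
by congr rsum; apply/funext => i; exact: (esym (mulrA _ _ _)).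
Qed.

Fact l2_inner_ge0 u : 0 <= l2_inner u u.
Proof.
rewrite /l2_inner rsum_ge0E => [|i]; last by rewrite -expr2 sqr_ge0.
by rewrite fine_ge0// esum_ge0// => i _; rewrite lee_fin -expr2 sqr_ge0.
Qed.

Lemma l2_inner_fsum (u : l2) (X : set I) : finite_set X ->
  \sum_(i \in X) u i ^+ 2 <= l2_inner u u.
Proof.
move=> fX; rewrite /l2_inner rsum_ge0E => [|i]; last by rewrite -expr2 sqr_ge0.
rewrite -lee_fin fineK.
  rewrite -fsumEFin//; apply: ereal_sup_ubound; exists X => //.
rewrite fin_numElt (lt_le_trans (ltNyr 0)) ?esum_ge0//=.
  by have := l2funP u; rewrite unfold_in.
by move=> i _; rewrite lee_fin -expr2 sqr_ge0.
Qed.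

Lemma l2_inner_coord (u : l2) i : u i ^+ 2 <= l2_inner u u.
Proof. by rewrite -(@fsbig_set1 _ 0 +%R _ i (fun i => u i ^+ 2)) l2_inner_fsum. Qed.

Fact l2_inner_eq0 u : l2_inner u u = 0 -> u = 0.
Proof.
move=> u0; apply/val_inj/funext => i /=; apply/eqP; rewrite -sqrf_eq0.
by rewrite eq_le sqr_ge0 -u0 l2_inner_coord.
Qed.

HB.instance Definition _ := Lmodule_hasInner.Build R l2
  l2_innerC l2_innerDl l2_innerZl l2_inner_ge0 l2_inner_eq0.

Lemma inner_l2E (u v : l2) : inner u v = rsum (fun i => u i * v i).
Proof. by []. Qed.

Lemma l2_coord_le (u : l2) i : `|u i| <= `|u|.
Proof.
by rewrite norm_inner -sqrtr_sqr ler_wsqrtr// l2_inner_coord.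
Qed.

Lemma l2_fsum_le (u : l2) (X : set I) : finite_set X ->
  \sum_(i \in X) u i ^+ 2 <= `|u| ^+ 2.
Proof. by move=> fX; rewrite -inner_norm; exact: l2_inner_fsum. Qed.

Lemma square_summable_fsum (f : I -> R) (M : R) :
  (forall X, finite_set X -> \sum_(i \in X) f i ^+ 2 <= M) ->
  (\esum_(i in [set: I]) (f i ^+ 2)%:E <= M%:E)%E.
Proof.
move=> h; apply: ge_ereal_sup => /= _ [X [fX _]] <-.
by rewrite fsumEFin// lee_fin h.
Qed.

Lemma l2_norm_fsum (u : l2) (M : R) :
  (forall X, finite_set X -> \sum_(i \in X) u i ^+ 2 <= M) -> `|u| ^+ 2 <= M.
Proof.
move=> /square_summable_fsum h; rewrite -inner_norm /inner/= /l2_inner.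
rewrite rsum_ge0E => [|i]; last by rewrite -expr2 sqr_ge0.
rewrite -lee_fin fineK// fin_numElt (lt_le_trans (ltNyr 0)) ?esum_ge0//=.
  by have := l2funP u; rewrite unfold_in.
by move=> i _; rewrite lee_fin -expr2 sqr_ge0.
Qed.

Lemma l2_complete (F : set_system l2) : ProperFilter F -> cauchy F -> cvg F.
Proof.
move=> PF /(cauchyP F).1 cF.
pose ev i (u : l2) := u i.
have cvg_ev i : cvg (ev i @ F).
  apply: R_complete; apply: cauchy_exP => e e0.
  have [u Fu] := cF e e0; exists (ev i u).
  suff : F (ev i @^-1` ball (ev i u) e) by [].
  apply: filterS Fu => v.
  rewrite -!ball_normE /= => uv; apply: le_lt_trans uv.
  exact: (l2_coord_le (u - v) i).
pose f i := lim (ev i @ F).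
have cvg_sum (v : l2) (s : seq I) :
    (fun w : l2 => \sum_(i <- s) (v i - w i) ^+ 2) @ F -->
    \sum_(i <- s) (v i - f i) ^+ 2.
  elim: s => [|j s IH].
    by rewrite big_nil; under eq_fun do rewrite big_nil; exact: cvg_cst.
  rewrite big_cons; under eq_fun do rewrite big_cons.
  apply: cvgD IH; under eq_fun do rewrite expr2; rewrite expr2.
  have h : (fun w : l2 => v j - w j) @ F --> v j - f j.
    by apply: cvgB; [exact: cvg_cst|exact: cvg_ev].
  exact: cvgM.
have key e : 0 < e -> exists2 u, F (ball u e) & forall v, ball u e v ->
    forall X, finite_set X -> \sum_(i \in X) (v i - f i) ^+ 2 <= (e + e) ^+ 2.
  move=> e0; have [u Fu] := cF e e0; exists u => // v uv X fX.
  rewrite fsbig_finite//=; apply: (cvgr_to_le (cvg_sum v _)).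
  apply: filterS Fu => w uw /=; rewrite -fsbig_finite//=.
  apply: le_trans (l2_fsum_le (v - w) fX) _.
  rewrite ler_pXn2r ?nnegrE// ?addr_ge0// ?ltW//.
  apply: le_lt_trans (ler_distD u _ _) _; apply: ltrD.
    by move: uv; rewrite -ball_normE/= distrC.
  by move: uw; rewrite -ball_normE.
have fS : f \in @square_summable R I.
  have [u Fu uP] := key 1 ltr01.
  have [v uv] := filter_ex Fu.
  have dS : (v : I -> R) - f \in @square_summable R I.
    rewrite unfold_in.
    exact: le_lt_trans (square_summable_fsum (uP v uv)) (ltry _).
  have -> : f = (v : I -> R) - ((v : I -> R) - f) by rewrite opprB addrC subrK.
  by rewrite rpredB//; exact: l2funP.
apply/cvg_ex; exists (L2 fS); apply/cvgrPdist_le => e e0.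
have [u Fu uP] := key (e / 2) (divr_gt0 e0 (ltr0n _ 2)).
apply: filterS Fu => v /uP h; rewrite distrC.
rewrite -(@ler_pXn2r _ 2) ?nnegrE ?(ltW e0)//; apply: l2_norm_fsum.
by move: h; rewrite -splitr.
Qed.

HB.instance Definition _ := Uniform_isComplete.Build l2 l2_complete.

End L2.

Lemma square_summable_fsupp (R : realType) (I : choiceType) (f : I -> R)
    (X : set I) : finite_set X -> (forall i, ~ X i -> f i = 0) ->
  f \in @square_summable R I.
Proof.
move=> fX f0; rewrite unfold_in.
have -> : (\esum_(i in [set: I]) (f i ^+ 2)%:E)%E =
          (\esum_(i in X) (f i ^+ 2)%:E)%E.
  rewrite [RHS]esum_mkcond; apply: eq_esum => i _.
  by case: ifPn => // /negP; rewrite inE => /f0 ->; rewrite expr0n.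
rewrite esum_fset// => [|i _]; last by rewrite lee_fin sqr_ge0.
by rewrite fsumEFin// ltry.
Qed.

(* [conductance_gt0] makes the edge set the support of the conductance. *)
Record network (R : realType) (V : countType) := Network {
  adj : rel V;
  conductance : V -> V -> R;
  adj_irr : irreflexive adj;
  adj_sym : symmetric adj;
  adj_finite : forall x, finite_set [set y | adj x y];
  adj_connected : forall x y, exists p, path adj x p /\ last x p = y;
  conductance_ge0 : forall x y, 0 <= conductance x y;
  conductance_sym : forall x y, conductance x y = conductance y x;
  conductance_gt0 : forall x y, (0 < conductance x y) = adj x y;
  vertex_infinite : infinite_set [set: V]
}.

Section EnergySpace.
Context {R : realType} {V : countType} (N : network R V).

(* The support of the sum is finite by local finiteness. *)
Definition laplacian (f : V -> R) (x : V) : R :=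
  \sum_(y \in [set y | adj N x y]) conductance N x y * (f x - f y).

Definition finite_energy : {pred V -> R} := fun u =>
  (\esum_(p in [set: V * V]) (conductance N p.1 p.2 * (u p.1 - u p.2) ^+ 2)%:E < +oo)%E.

Definition energy (u v : V -> R) : R :=
  2^-1 * rsum (fun p : V * V =>
    conductance N p.1 p.2 * (u p.1 - u p.2) * (v p.1 - v p.2)).

Definition grad (u : V -> R) (p : V * V) : R :=
  Num.sqrt (conductance N p.1 p.2) * (u p.1 - u p.2).

Lemma finite_energy_grad u :
  (u \in finite_energy) = (grad u \in @square_summable R (V * V)%type).
Proof.
rewrite !unfold_in /finite_energy /square_summable; congr (_ < _)%E.
by apply: eq_esum => p _; rewrite /grad exprMn sqr_sqrtr ?conductance_ge0.
Qed.

Lemma gradP a u v : grad (a *: u + v) = a *: grad u + grad v.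
Proof.
apply/funext => p; rewrite /grad.
rewrite -[(a *: u + v) p.1]/(a * u p.1 + v p.1).
rewrite -[(a *: u + v) p.2]/(a * u p.2 + v p.2).
by rewrite -[RHS]/(a * grad u p + grad v p) /grad; ring.
Qed.

Lemma finite_energy_submod : submod_closed finite_energy.
Proof.
split.
  rewrite finite_energy_grad.
  have -> : grad 0 = 0 by apply/funext => p; rewrite /grad subrr mulr0.
  exact: rpred0.
move=> a u v; rewrite !finite_energy_grad gradP => uS vS.
by rewrite rpredD// rpredZ.
Qed.

HB.instance Definition _ :=
  GRing.isSubmodClosed.Build R (V -> R) finite_energy finite_energy_submod.

Record energy_fun := EnergyFun {
  energy_fun_val :> V -> R;
  energy_funP : energy_fun_val \in finite_energy }.

HB.instance Definition _ := [isSub for energy_fun_val].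
HB.instance Definition _ := [Choice of energy_fun by <:].
HB.instance Definition _ := [SubChoice_isSubLmodule of energy_fun by <:].

(* The finite energy Hilbert space is the quotient of [energy_fun] by the
   constants. It is already complete (see [energy_complete]), so no further
   completion is needed. *)
Definition constant_fun : {pred energy_fun} :=
  fun u => `[< exists k, forall x, u x = k >].

Lemma constant_fun_zmod : zmod_closed constant_fun.
Proof.
split; first by apply/asboolP; exists 0.
move=> u v /asboolP[k uk] /asboolP[l vl]; apply/asboolP; exists (k - l) => x.
by rewrite -[LHS]/(u x - v x) uk vl.
Qed.

HB.instance Definition _ :=
  GRing.isZmodClosed.Build energy_fun constant_fun constant_fun_zmod.

Definition energy_space : Type := Quotient.quot constant_fun.

HB.instance Definition _ := Choice.on energy_space.
HB.instance Definition _ := GRing.Zmodule.on energy_space.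

Definition energy_class (u : energy_fun) : energy_space := (\pi_(energy_space) u)%qT.
Definition energy_repr (a : energy_space) : energy_fun := repr a.
(* u(x) - u(y), which does not depend on the representative of the class
   (see [incr_energy_class]). *)
Definition incr (a : energy_space) (x y : V) : R := energy_repr a x - energy_repr a y.

Lemma energy_classD u v : energy_class (u + v) = energy_class u + energy_class v.
Proof. by rewrite /energy_class raddfD. Qed.
Lemma energy_classK a : energy_class (energy_repr a) = a.
Proof. exact: reprK. Qed.
Lemma energy_class_eqP (u v : energy_fun) :
  energy_class u = energy_class v <-> forall x y, u x - u y = v x - v y.
Proof.
split=> [/eqP|uv].
  rewrite -Quotient.idealrBE => /asboolP[k uvk] x y.
  have := uvk x; have := uvk y.
  rewrite -[(u - v) x]/(u x - v x) -[(u - v) y]/(u y - v y) => h1 h2; lra.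
apply/eqP; rewrite -Quotient.idealrBE; apply/asboolP.
have [ o _] := infinite_setN0 (vertex_infinite N).
exists (u o - v o) => x; rewrite -[(u - v) x]/(u x - v x).
have := uv x o; lra.
Qed.

Lemma incr_energy_class u x y : incr (energy_class u) x y = u x - u y.
Proof. by have /energy_class_eqP := energy_classK (energy_class u); apply. Qed.

Lemma incr_inj a b : (forall x y, incr a x y = incr b x y) -> a = b.
Proof. by rewrite -{2}(energy_classK a) -{2}(energy_classK b) => /energy_class_eqP. Qed.

Lemma incrD a b x y : incr (a + b) x y = incr a x y + incr b x y.
Proof.
rewrite -(energy_classK a) -(energy_classK b) -energy_classD !incr_energy_class.
set u := energy_repr a; set v := energy_repr b.
by rewrite -[(u + v) x]/(u x + v x) -[(u + v) y]/(u y + v y); ring.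
Qed.

Definition energy_scale (k : R) (a : energy_space) : energy_space :=
  energy_class (k *: energy_repr a).

Fact incr_scale k a x y : incr (energy_scale k a) x y = k * incr a x y.
Proof.
rewrite incr_energy_class /incr; set u := energy_repr a.
by rewrite -[(k *: u) x]/(k * u x) -[(k *: u) y]/(k * u y); ring.
Qed.

Fact energy_scalerA k l a :
  energy_scale k (energy_scale l a) = energy_scale (k * l) a.
Proof. by apply: incr_inj => x y; rewrite !incr_scale mulrA. Qed.

Fact energy_scale1r : left_id 1 energy_scale.
Proof. by move=> a; apply: incr_inj => x y; rewrite incr_scale mul1r. Qed.

Fact energy_scalerDr : right_distributive energy_scale +%R.
Proof.
by move=> k a b; apply: incr_inj => x y; rewrite !(incrD, incr_scale) mulrDr.
Qed.

Fact energy_scalerDl a : {morph energy_scale^~ a : k l / k + l}.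
Proof.
by move=> k l; apply: incr_inj => x y; rewrite !(incrD, incr_scale) mulrDl.
Qed.

HB.instance Definition _ := GRing.Zmodule_isLmodule.Build R energy_space
  energy_scalerA energy_scale1r energy_scalerDr energy_scalerDl.

Lemma incrZ k a x y : incr (k *: a) x y = k * incr a x y.
Proof. exact: incr_scale. Qed.

Lemma incrB a b x y : incr (a - b) x y = incr a x y - incr b x y.
Proof. by rewrite -scaleN1r incrD incrZ mulN1r. Qed.

Definition energy_inner (a b : energy_space) : R := energy (energy_repr a) (energy_repr b).

Fact grad_reprP a : grad (energy_repr a) \in @square_summable R (V * V)%type.
Proof. by rewrite -finite_energy_grad; exact: energy_funP. Qed.

Definition grad_class (a : energy_space) : l2 R (V * V)%type := L2 (grad_reprP a).

Lemma grad_classE a p :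
  grad_class a p = Num.sqrt (conductance N p.1 p.2) * incr a p.1 p.2.
Proof. by []. Qed.

Lemma grad_classD a b : grad_class (a + b) = grad_class a + grad_class b.
Proof.
apply/val_inj/funext => p /=.
by rewrite -[LHS]/(grad_class (a + b) p) grad_classE incrD mulrDr.
Qed.

Lemma grad_classZ k a : grad_class (k *: a) = k *: grad_class a.
Proof.
apply/val_inj/funext => p /=.
by rewrite -[LHS]/(grad_class (k *: a) p) grad_classE incrZ mulrCA.
Qed.

Lemma grad_classB a b : grad_class (a - b) = grad_class a - grad_class b.
Proof. by rewrite grad_classD -scaleN1r grad_classZ scaleN1r. Qed.

Lemma energy_innerE a b :
  energy_inner a b = 2^-1 * inner (grad_class a) (grad_class b).
Proof.
congr (_ * _); congr rsum; apply/funext => p /=; rewrite /grad.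
by rewrite mulrACA -expr2 sqr_sqrtr ?conductance_ge0// mulrA.
Qed.

Fact energy_innerC a b : energy_inner a b = energy_inner b a.
Proof. by rewrite !energy_innerE innerC. Qed.

Fact energy_innerDl a b c :
  energy_inner (a + b) c = energy_inner a c + energy_inner b c.
Proof. by rewrite !energy_innerE grad_classD innerDl mulrDr. Qed.

Fact energy_innerZl k a b : energy_inner (k *: a) b = k * energy_inner a b.
Proof. by rewrite !energy_innerE grad_classZ innerZl mulrCA. Qed.

Fact energy_inner_ge0 a : 0 <= energy_inner a a.
Proof. by rewrite energy_innerE inner_norm mulr_ge0// invr_ge0. Qed.

Fact energy_inner_eq0 a : energy_inner a a = 0 -> a = 0.
Proof.
move=> /eqP; rewrite energy_innerE inner_norm mulf_eq0 invr_eq0 pnatr_eq0/=.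
rewrite expf_eq0/= normr_eq0 => /eqP a0.
have step x y : adj N x y -> incr a x y = 0.
  move=> xy; apply/eqP.
  have /eqP : grad_class a (x, y) = 0 by rewrite a0.
  by rewrite grad_classE mulf_eq0 sqrtr_eq0 leNgt conductance_gt0/= xy.
apply: incr_inj => x y; rewrite -[0](scale0r a) incrZ mul0r.
have [p [+ <-]] := adj_connected N x y.
elim: p x => [|z p IH] x /=; first by rewrite /incr subrr.
move=> /andP[xz zp]; have := IH z zp; have := step _ _ xz; rewrite /incr; lra.
Qed.

HB.instance Definition _ := Lmodule_hasInner.Build R energy_space
  energy_innerC energy_innerDl energy_innerZl energy_inner_ge0 energy_inner_eq0.

Lemma inner_energyE (a b : energy_space) :
  inner a b = energy (energy_repr a) (energy_repr b).
Proof. by []. Qed.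

Lemma energy_norm a : `|a| = Num.sqrt 2^-1 * `|grad_class a|.
Proof.
rewrite norm_inner [inner _ _]energy_innerE inner_norm sqrtrM ?invr_ge0//.
by rewrite sqrtr_sqr normr_id.
Qed.

Lemma energy_complete (F : set_system energy_space) :
  ProperFilter F -> cauchy F -> cvg F.
Proof.
move=> PF /(cauchyP F).1 cF.
have s0 : 0 < Num.sqrt 2^-1 :> R by rewrite sqrtr_gt0 invr_gt0.
have /cvg_ex[/= g Fg] : cvg (grad_class @ F).
  apply: cauchy_cvg; apply: cauchy_exP => e e0.
  have [a Fa] := cF _ (mulr_gt0 s0 e0); exists (grad_class a).
  suff : F (grad_class @^-1` ball (grad_class a) e) by [].
  apply: filterS Fa => b; rewrite -!ball_normE /= energy_norm grad_classB.
  by rewrite ltr_pM2l.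
have cvg_coord p : (fun a => grad_class a p) @ F --> g p.
  apply/cvgrPdist_lt => e e0; move/cvgrPdist_lt : Fg => /(_ e e0).
  apply: filterS => a; apply: le_lt_trans.
  exact: (l2_coord_le (g - grad_class a) p).
have cvg_diff x y : cvg ((fun a => incr a x y) @ F).
  have [p [+ <-]] := adj_connected N x y.
  elim: p x => [|z p IH] x /=.
    by move=> _; rewrite /incr; under eq_fun do rewrite subrr; exact: is_cvg_cst.
  move=> /andP[xz /IH zp].
  have -> : (fun a => incr a x (last z p)) =
    (fun a => (Num.sqrt (conductance N x z))^-1 * grad_class a (x, z) +
              incr a z (last z p)).
    apply/funext => a; rewrite grad_classE /= mulKf; last first.
      by rewrite sqrtr_eq0 -ltNge conductance_gt0.
    by rewrite /incr; ring.
  apply: is_cvgD => //; apply: is_cvgM; first exact: is_cvg_cst.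
  by apply/cvg_ex; exists (g (x, z)); exact: cvg_coord.
have [ o _] := infinite_setN0 (vertex_infinite N).
pose u x := lim ((fun a => incr a x o) @ F).
have gradu : grad u = g.
  apply/funext => p; rewrite /grad.
  have h : (fun a => grad_class a p) @ F -->
      Num.sqrt (conductance N p.1 p.2) * (u p.1 - u p.2).
    have -> : (fun a => grad_class a p) = (fun a =>
        Num.sqrt (conductance N p.1 p.2) * (incr a p.1 o - incr a p.2 o)).
      by apply/funext => a; rewrite grad_classE /incr; ring.
    by apply: cvgM; [exact: cvg_cst|apply: cvgB; exact: cvg_diff].
  exact: (cvg_unique _ h (cvg_coord p)).
have uE : u \in finite_energy.
  by rewrite finite_energy_grad gradu; exact: l2funP.
have gE : grad_class (energy_class (EnergyFun uE)) = g.
  apply/val_inj; apply: etrans gradu; apply/funext => p.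
  by rewrite -[LHS]/(grad_class _ p) grad_classE incr_energy_class.
apply/cvg_ex; exists (energy_class (EnergyFun uE)); apply/cvgrPdist_lt => e e0.
move/cvgrPdist_lt : Fg => /(_ _ (divr_gt0 e0 s0)).
apply: filterS => a; rewrite energy_norm grad_classB gE.
by rewrite ltr_pdivlMr// mulrC.
Qed.

HB.instance Definition _ := Uniform_isComplete.Build energy_space energy_complete.

End EnergySpace.

(* An unbounded operator from H to K is represented by its graph, a subset of
   H * K, so that closures and adjoints are defined without side conditions. *)
Section Operators.
Context {R : realType}.

Definition lspan (E : lmodType R) (X : set E) : set E :=
  [set u | exists n (a : 'I_n -> R) (v : 'I_n -> E),
    (forall i, X (v i)) /\ u = \sum_(i < n) a i *: v i].

Definition single_valued (H K : Type) (A : set (H * K)) :=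
  forall x y z, A (x, y) -> A (x, z) -> y = z.

Definition op_dom (H K : Type) (A : set (H * K)) : set H :=
  [set x | exists y, A (x, y)].

(* [comp_op B A] is B after A. *)
Definition comp_op (H K L : Type) (B : set (K * L)) (A : set (H * K)) :
  set (H * L) := [set p | exists2 y, A (p.1, y) & B (y, p.2)].

(* The closure of the graph is taken in the product topology of H * K. *)
Definition closable (H K : hilbertType R) (A : set (H * K)) :=
  single_valued (closure A).

(* (y, z) is in the adjoint iff <A x, y> = <x, z> for all x in the domain. *)
Definition adjoint (H K : hilbertType R) (A : set (H * K)) : set (K * H) :=
  [set q | forall x Ax, A (x, Ax) -> inner Ax q.1 = inner x q.2].

(* Density of the domain makes the adjoint, hence A itself, single-valued. *)
Definition self_adjoint (H : hilbertType R) (A : set (H * H)) :=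
  dense (op_dom A) /\ adjoint A = A.

Definition self_adjoint_extension (H : hilbertType R) (B A : set (H * H)) :=
  self_adjoint B /\ A `<=` B.

End Operators.

Definition kronecker (R : realType) (V : countType) (x : V) : V -> R :=
  fun y => (y == x)%:R.

Fact kronecker_l2 (R : realType) (V : countType) (x : V) :
  kronecker R x \in @square_summable R V.
Proof.
apply: (@square_summable_fsupp _ _ _ [set x]); first exact: finite_set1.
by move=> y /eqP/negPf; rewrite /kronecker => ->.
Qed.

Fact kronecker_energy (R : realType) (V : countType) (N : network R V) (x : V) :
  kronecker R x \in finite_energy N.
Proof.
rewrite finite_energy_grad.
pose X := [set y | adj N x y].
apply: (@square_summable_fsupp _ _ _
  ((fun y => (x, y)) @` X `|` (fun y => (y, x)) @` X)).
  by rewrite finite_setU; split; apply: finite_image; exact: adj_finite.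
move=> [y z] /= yzX; rewrite /grad /= /kronecker.
have [yx|yx] := eqVneq y x; have [zx|zx] := eqVneq z x; rewrite ?subrr ?mulr0//.
  suff /negPf xz : ~~ adj N x z.
    suff -> : Num.sqrt (conductance N y z) = 0 by rewrite mul0r.
    by apply/eqP; rewrite yx sqrtr_eq0 leNgt conductance_gt0 xz.
  by apply/negP => xz; apply: yzX; left; exists z; rewrite ?yx.
suff /negPf xy : ~~ adj N x y.
  suff -> : Num.sqrt (conductance N y z) = 0 by rewrite mul0r.
  by apply/eqP; rewrite zx sqrtr_eq0 leNgt conductance_gt0 adj_sym xy.
by apply/negP => xy; apply: yzX; right; exists y; rewrite ?zx.
Qed.

Section NetworkOperators.
Context {R : realType} {V : countType} (N : network R V) (o : V).

Definition delta_l2 (x : V) : l2 R V := L2 (kronecker_l2 R x).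

Definition delta_energy (x : V) : energy_space N :=
  energy_class (EnergyFun (kronecker_energy N x)).

(* The set below is a singleton by the Riesz representation theorem, so the
   default value 0 is never used. *)
Definition dipole (x : V) : energy_space N :=
  xget 0 [set v | forall u, inner v u = incr u x o].

Definition opT : set (l2 R V * energy_space N) :=
  lspan (range (fun x => (delta_l2 x, delta_energy x))).

Definition opS : set (energy_space N * l2 R V) :=
  lspan (range (fun x => (dipole x, delta_l2 x - delta_l2 o))).

Definition laplacian_l2 : set (l2 R V * l2 R V) :=
  closure [set p : l2 R V * l2 R V | lspan (range delta_l2) p.1 /\
    (p.2 : V -> R) = laplacian N p.1].

Definition laplacian_energy : set (energy_space N * energy_space N) :=
  closure [set p : energy_space N * energy_space N | lspan (range dipole) p.1 /\
    exists2 w : energy_fun N, p.2 = energy_class w &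
      (w : V -> R) = laplacian N (energy_repr p.1)].

End NetworkOperators.

Arguments opT {R V} N _.
Arguments opS {R V} N o _.
Arguments laplacian_l2 {R V} N _.
Arguments laplacian_energy {R V} N o _.

(* Main.v *)
Require Import Defs.
From HB Require Import structures.
From mathcomp Require Import all_boot all_order all_algebra.
From mathcomp Require Import all_classical all_reals all_analysis.
From mathcomp Require Import ring lra.

Set Implicit Arguments.
Unset Strict Implicit.
Unset Printing Implicit Defensive.

Import Order.TTheory GRing.Theory Num.Theory.
Import numFieldNormedType.Exports.
Local Open Scope classical_set_scope.
Local Open Scope ring_scope.

(** The operators [T] and [S] are formally adjoint to each other:
    [<v_x, T delta_y> = delta_y(x) - delta_y(o) = <S v_x, delta_y>]
    ([inner_dipole_delta]), by the reproducing property of the dipoles. So the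
    adjoint of [T] is defined on the dipoles and the adjoint of [S] on the point
    masses. Both families are total, since a vector orthogonal to all dipoles
    has no increments and one orthogonal to all point masses has no values;
    hence both operators are densely defined and closable.

    Von Neumann's theorem ([von_neumann]) says that [A^* A] is self-adjoint for
    every closed, densely defined [A]. Its analytic content is that [1 + A^* A]
    is onto, which is the Riesz representation theorem in the Hilbert space
    formed by the graph of [A]. This, the existence of the dipoles and the
    density of total subspaces all come from one minimisation argument
    ([sym_lax_milgram]).

    A self-adjoint operator is closed, so it extends the closed Laplacian as
    soon as it extends the Laplacian on the spanning vectors. The Green formula
    [<delta_y, u> = (Delta u)(y)] ([inner_delta_energy]) gives this in both
    cases. On the span of the point masses, it says that the adjoint of [T]
    sends [T f] to [Delta f]. On the span of the dipoles, it says that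
    [S v = Delta v]; the reproducing property of the dipoles then says that the
    adjoint of [S] sends [Delta v], as an element of l2, to its class in the
    energy space. *)

(** * Linear subspaces and spans *)

Definition linear_subspace (R : realType) (E : lmodType R) (M : set E) :=
  M 0 /\ forall (a : R) u v, M u -> M v -> M (a *: u + v).

Lemma closure_full_dense (T : topologicalType) (A : set T) :
  (forall x, closure A x) -> dense A.
Proof.
move=> clA O [x Ox] oO.
have [y [Ay Oy]] := clA x O (open_nbhs_nbhs (conj oO Ox)).
by exists y.
Qed.

Lemma closure_linear_subspace (R : realType) (E : normedModType R) (M : set E) :
  linear_subspace M -> linear_subspace (closure M).
Proof.
move=> [M0 Ml]; split; first exact: subset_closure.
have step (f : E -> E) : continuous f -> (forall u, M u -> closure M (f u)) ->
    forall u, closure M u -> closure M (f u).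
  move=> /continuous_closedP/(_ _ (@closed_closure _ M)).
  by move=> fcl Mf u Mu; apply: fcl; exact: closureS Mu.
move=> a u v Mu Mv.
apply: (step (fun u => a *: u + v)) Mu => [x|w Mw].
  by apply: cvgD; [exact: scaler_continuous|exact: cvg_cst].
apply: (step (fun v => a *: w + v)) Mv => [x|z Mz].
  by apply: cvgD; [exact: cvg_cst|exact: cvg_id].
exact/subset_closure/Ml.
Qed.

Lemma lspan_linear_subspace (R : realType) (E : lmodType R) (X : set E) :
  linear_subspace (lspan X).
Proof.
split.
  exists 0%N, (fun=> 0), (fun=> 0); split; first by case.
  by rewrite big_ord0.
move=> c _ _ [n [a [u [Xu ->]]]] [k [b [v [Xv ->]]]].
exists (n + k)%N,
  (fun i => match fintype.split i with inl j => c * a j | inr j => b j end),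
  (fun i => match fintype.split i with inl j => u j | inr j => v j end); split.
  by move=> i; case: fintype.split.
rewrite big_split_ord scaler_sumr; congr (_ + _); apply: eq_bigr => i _.
  by rewrite (unsplitK (inl _ i)) scalerA.
by rewrite (unsplitK (inr _ i)).
Qed.

Lemma lspan_sub (R : realType) (E : lmodType R) (X M : set E) :
  linear_subspace M -> X `<=` M -> lspan X `<=` M.
Proof.
move=> [M0 Ml] XM _ [n [a [v [Xv ->]]]].
elim/big_ind: _ => // [x y Mx My|i _]; first by rewrite -[x]scale1r; exact: Ml.
by rewrite -[_ *: _]addr0; apply: Ml => //; exact: XM.
Qed.

Lemma sub_lspan (R : realType) (E : lmodType R) (X : set E) : X `<=` lspan X.
Proof.
move=> x Xx; exists 1%N, (fun=> 1), (fun=> x); split=> //.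
by rewrite big_ord1 scale1r.
Qed.

Lemma op_dom_lspan (R : realType) (E F : lmodType R) (T : Type)
    (f : T -> E) (g : T -> F) (u : E) :
  lspan (range f) u -> exists w, lspan (range (fun x => (f x, g x))) (u, w).
Proof.
move=> [n [a [v [fv ->]]]].
have /choice[x xv] i : exists x, f x = v i by have [x _ <-] := fv i; exists x.
exists (\sum_(i < n) a i *: g (x i)), n, a, (fun i => (f (x i), g (x i))); split.
  by move=> i; exists (x i).
rewrite [RHS]surjective_pairing; congr pair.
  by rewrite (raddf_sum fst); apply: eq_bigr => i _ /=; rewrite xv.
by rewrite (raddf_sum snd).
Qed.

(** * Minimising a quadratic functional *)

(** Completeness of the ambient space of operator graphs: both coordinates of a
    Cauchy filter converge. *)
Lemma complete_pair_cvg (R : realType) (U W : completeNormedModType R)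
    (F : set_system (U * W)) :
  ProperFilter F -> cauchy F -> exists l : U * W, F --> l.
Proof.
move=> PF /cauchyP cF.
have cvg1 : cvg (fst @ F).
  apply: cauchy_cvg; apply: cauchy_exP => e e0.
  have [p Fp] := cF e e0; exists p.1.
  suff : F (fst @^-1` ball p.1 e) by [].
  by apply: filterS Fp => q [].
have cvg2 : cvg (snd @ F).
  apply: cauchy_cvg; apply: cauchy_exP => e e0.
  have [p Fp] := cF e e0; exists p.2.
  suff : F (snd @^-1` ball p.2 e) by [].
  by apply: filterS Fp => q [].
exists (lim (fst @ F), lim (snd @ F)).
have := cvg_pair cvg1 cvg2.
rewrite (_ : (fun x : U * W => (x.1, x.2)) = id); first exact.
by apply/funext => -[].
Qed.

(** First-order condition at a minimum, in the form in which it is used: a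
    quadratic polynomial in [t] with minimum value 0 at [t = 0] has no linear
    term. *)
Lemma quadratic_ge0_lin0 (R : realType) (B g : R) : 0 <= B ->
  (forall t, 0 <= t ^+ 2 * B + 2 * t * g) -> g = 0.
Proof.
(* The minimiser is - g / B; the shift by 1 avoids the case B = 0. *)
move=> B0 /(_ (- g / (B + 1))).
have B1 : 0 < B + 1 by rewrite ltr_wpDl.
have -> : (- g / (B + 1)) ^+ 2 * B + 2 * (- g / (B + 1)) * g =
   - (g ^+ 2 * ((B + 2) / (B + 1) ^+ 2)) by field; rewrite gt_eqF.
rewrite oppr_ge0 pmulr_lle0; last by rewrite divr_gt0 ?exprn_gt0// ltr_wpDl.
by move=> g2; apply/eqP; rewrite -sqrf_eq0 eq_le g2 sqr_ge0.
Qed.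

Lemma bounded_linear_form_continuous (R : realType) (E : normedModType R)
    (phi : E -> R) (C : R) :
  (forall a u v, phi (a *: u + v) = a * phi u + phi v) ->
  (forall u, `|phi u| <= C * `|u|) -> continuous phi.
Proof.
move=> phil phiC y; apply/cvgrPdist_lt => e e0.
have C1 : 0 < `|C| + 1 by rewrite ltr_wpDl.
have d0 : 0 < e / (`|C| + 1) by rewrite divr_gt0.
near=> z.
have -> : phi y - phi z = phi (y - z).
  by have := phil (-1) z y; rewrite scaleN1r addrC => ->; rewrite mulN1r addrC.
apply: le_lt_trans (phiC _) _.
apply: (@le_lt_trans _ _ ((`|C| + 1) * `|y - z|)).
  rewrite ler_wpM2r//; have := ler_norm C; lra.
rewrite mulrC -ltr_pdivlMr//; near: z.
Unshelve. all: by end_near. Qed.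

(** Symmetric Lax-Milgram theorem on a closed subspace [M]. The solution is the
    minimiser of [J u = b u u - 2 * phi u]: by the parallelogram identity,
    [b (u - v) (u - v) / 2 = J u + J v - 2 * J ((u + v) / 2)], so the sublevel
    sets of [J] close to its infimum have small diameter and shrink to a point.
    Completeness is a hypothesis about filters so that the lemma applies to the
    product [H * K] with its maximum norm; there [b] is the inner product of the
    Hilbert sum, whose norm is only equivalent to the norm of the space. *)
Lemma sym_lax_milgram (R : realType) (E : normedModType R) (M : set E)
    (b : E -> E -> R) (phi : E -> R) (C : R) :
  (forall F : set_system E,
    ProperFilter F -> cauchy F -> exists l : E, F --> l) ->
  closed M -> linear_subspace M ->
  (forall u v, b u v = b v u) ->
  (forall a u v w, b (a *: u + v) w = a * b u w + b v w) ->
  (forall u, `|u| ^+ 2 <= b u u) -> continuous (fun u => b u u) ->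
  (forall a u v, phi (a *: u + v) = a * phi u + phi v) ->
  (forall u, `|phi u| <= C * `|u|) ->
  exists2 l, M l & forall u, M u -> b l u = phi u.
Proof.
move=> complE Mcl [M0 Mlin] bC bl bcoer bcont phil phiC.
have phicont := bounded_linear_form_continuous phil phiC.
pose J u := b u u - 2 * phi u.
have Jcont : continuous J.
  move=> x; apply: cvgB; first exact: bcont.
  by apply: cvgM; [exact: cvg_cst|exact: phicont].
have br a u v w : b w (a *: u + v) = a * b w u + b w v.
  by rewrite bC bl !(bC w).
have Jlb u : - C ^+ 2 <= J u.
  have := bcoer u; have := phiC u; rewrite ler_norml => /andP[_].
  rewrite /J; have := sqr_ge0 (`|u| - C); rewrite sqrrB; lra.
pose m := inf (J @` M).
have hinf : has_inf (J @` M).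
  split; first by exists (J 0); exists 0.
  by exists (- C ^+ 2) => _ [u _ <-].
have mJ u : M u -> m <= J u.
  by move=> Mu; apply: ge_inf; [exact: hinf.2|exists u].
pose L (e : R) := [set u | M u /\ J u < m + e].
have L0 e : 0 < e -> exists u, L e u.
  by move=> e0; have [_ [u Mu <-] ue] := inf_adherent e0 hinf; exists u.
pose F := filter_from [set e : R | 0 < e] L.
have PF : ProperFilter F.
  apply: filter_from_proper; last by move=> e /= e0; exact: L0.
  apply: filter_from_filter; first by exists 1 => /=.
  move=> e f /= e0 f0; exists (Num.min e f); first by rewrite /= lt_min e0.
  move=> u [Mu Ju]; split; split=> //; apply: (lt_le_trans Ju);
    by rewrite lerD2l ge_min lexx ?orbT.
(* J at the midpoint of u and v is at least m. *)
have para e u v : L e u -> L e v -> `|u - v| ^+ 2 <= 4 * e.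
  move=> [Mu Ju] [Mv Jv]; apply: le_trans (bcoer _) _.
  have M2 : M (2^-1 *: u + (2^-1 *: v + 0)) by do 2!apply: (Mlin _ _ _) => //.
  have := mJ _ M2; move: Ju Jv; rewrite /J.
  have b0 w : b 0 w = 0 by have := bl 1 0 0 w; rewrite scaler0 addr0; lra.
  have b0r w : b w 0 = 0 by rewrite bC.
  have phi0 : phi 0 = 0 by have := phil 1 0 0; rewrite scaler0 addr0; lra.
  rewrite !(bl, br, phil, b0, b0r, phi0).
  have -> : u - v = (-1) *: v + u by rewrite scaleN1r addrC.
  rewrite !(bl, br) (bC v u); lra.
have [l Fl] : exists l : E, F --> l.
  apply: complE; apply: cauchy_exP => e e0.
  have d0 : 0 < e ^+ 2 / 8 by rewrite divr_gt0// exprn_gt0.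
  have [u Lu] := L0 _ d0; exists u; exists (e ^+ 2 / 8) => // v Lv.
  rewrite -ball_normE /= -(@ltr_pXn2r _ 2) ?nnegrE ?(ltW e0)//.
  by apply: le_lt_trans (para _ _ _ Lu Lv) _; have := exprn_gt0 2 e0; lra.
have Ml : M l.
  apply: Mcl => B /Fl [e e0 LB]; have [u Lu] := L0 _ e0.
  by exists u; split; [case: Lu|exact: LB].
have Jl : J l <= m.
  apply/ler_addgt0Pr => e e0.
  have FJ : J @ F --> J l by apply: cvg_trans (Jcont l); exact: cvg_app.
  apply: (cvgr_to_le FJ); exists e => // u [_ /ltW]; exact.
exists l => // u Mu; apply/eqP; rewrite -subr_eq0; apply/eqP.
apply: (@quadratic_ge0_lin0 _ (b u u)); first exact: le_trans (bcoer _).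
move=> t; have := mJ _ (Mlin t u l Mu Ml).
rewrite /J !(bl, br, phil) (bC u l); rewrite /J in Jl; lra.
Qed.

(** * Inner products *)

Section InnerProduct.
Context {R : realType} {H : preHilbertType R}.
Implicit Types x y z : H.

Lemma innerDr z x y : inner z (x + y) = inner z x + inner z y.
Proof. by rewrite innerC innerDl !(innerC z). Qed.

Lemma innerZr a x y : inner x (a *: y) = a * inner x y.
Proof. by rewrite innerC innerZl (innerC x). Qed.

Lemma innerBl x y z : inner (x - y) z = inner x z - inner y z.
Proof. by rewrite innerDl -scaleN1r innerZl mulN1r. Qed.

Lemma innerBr z x y : inner z (x - y) = inner z x - inner z y.
Proof. by rewrite innerC innerBl !(innerC z). Qed.

Lemma inner0l x : inner 0 x = 0.
Proof. by rewrite -(scale0r 0) innerZl mul0r. Qed.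

Lemma inner0r x : inner x 0 = 0.
Proof. by rewrite innerC inner0l. Qed.

Lemma inner_eq0 x : inner x x = 0 -> x = 0.
Proof. by move/eqP; rewrite inner_norm sqrf_eq0 normr_eq0 => /eqP. Qed.

Lemma cauchy_schwarz x y : `|inner x y| <= `|x| * `|y|.
Proof.
have [->|x0] := eqVneq x 0; first by rewrite inner0l !normr0 mul0r.
have nx : 0 < `|x| by rewrite normr_gt0.
rewrite -(@ler_pXn2r _ 2) ?nnegrE ?mulr_ge0// real_normK ?num_real//.
rewrite exprMn -!inner_norm.
have xx : 0 < inner x x by rewrite inner_norm exprn_gt0.
pose w := inner x x *: y - inner x y *: x.
have : 0 <= inner w w.
  by rewrite inner_norm exprn_ge0.
rewrite /w !(innerBl, innerBr, innerZl, innerZr) (innerC y x) => h.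
rewrite -subr_ge0 -(pmulr_rge0 _ xx); apply: le_trans h _.
by rewrite le_eqVlt; apply/orP; left; apply/eqP; ring.
Qed.

Lemma inner_continuousr x : continuous (inner x : H -> R).
Proof.
apply: bounded_linear_form_continuous (cauchy_schwarz x) => a u v.
by rewrite innerDr innerZr.
Qed.

Lemma inner_continuousl y : continuous (fun x : H => inner x y).
Proof.
rewrite (_ : (fun _ => _) = inner y); first exact: inner_continuousr.
by apply/funext => x; rewrite innerC.
Qed.

Lemma inner_sqr_continuous : continuous (fun x : H => inner x x).
Proof.
rewrite (_ : (fun x => inner x x) = (fun x : H => `|x| * `|x|)).
  by move=> x; apply: cvgM; exact: norm_continuous.
by apply/funext => x; rewrite inner_norm expr2.
Qed.

End InnerProduct.

(** * Riesz representation and dense subspaces *)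

Lemma riesz (R : realType) (H : hilbertType R) (phi : H -> R) (C : R) :
  (forall a u v, phi (a *: u + v) = a * phi u + phi v) ->
  (forall u, `|phi u| <= C * `|u|) ->
  exists v, forall u, inner v u = phi u.
Proof.
move=> phil phiC.
have [l _ lP] : exists2 l, [set: H] l &
    forall u, [set: H] u -> inner l u = phi u.
  apply: (@sym_lax_milgram _ _ _ _ _ C) => //.
  - by move=> F PF cF; apply/cvg_ex; exact: cauchy_cvg.
  - exact: innerC.
  - by move=> a u v w; rewrite innerDl innerZl.
  - by move=> u; rewrite inner_norm.
  - exact: inner_sqr_continuous.
by exists l => u; exact: lP.
Qed.

(** Trivial orthogonal complement: for a linear subspace this amounts to density
    (see [total_linear_dense]), but it can be checked on generators. *)
Definition total_set (R : realType) (H : hilbertType R) (X : set H) :=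
  forall d, (forall x, X x -> inner x d = 0) -> d = 0.

(** The orthogonal projection [l] of [h] on the closure of [M] represents the
    form [inner h] there, so [h - l] is orthogonal to [M] and vanishes. *)
Lemma total_linear_dense (R : realType) (H : hilbertType R) (M : set H) :
  linear_subspace M -> total_set M -> dense M.
Proof.
move=> Mlin Mtot; apply: closure_full_dense => h.
have [l Ml lh] : exists2 l, closure M l &
    forall u, closure M u -> inner l u = inner h u.
  apply: (@sym_lax_milgram _ _ _ _ _ `|h|).
  - by move=> F PF cF; apply/cvg_ex; exact: cauchy_cvg.
  - exact: closed_closure.
  - exact: closure_linear_subspace.
  - exact: innerC.
  - by move=> a u v w; rewrite innerDl innerZl.
  - by move=> u; rewrite inner_norm.
  - exact: inner_sqr_continuous.
  - by move=> a u v; rewrite innerDr innerZr.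
  - exact: cauchy_schwarz.
suff -> : h = l by [].
apply/eqP; rewrite -subr_eq0; apply/eqP/Mtot => x Mx.
by rewrite innerBr ![inner x _]innerC lh ?subrr//; exact: subset_closure.
Qed.

(** * Adjoints and von Neumann's theorem *)

Section Adjoint.
Context {R : realType} {H K : hilbertType R}.
Implicit Type A : set (H * K).

Lemma comp_fst_continuous (f : H -> R) :
  continuous f -> continuous (fun p : H * K => f p.1).
Proof. by move=> fc p; apply: continuous_comp; [exact: cvg_fst|exact: fc]. Qed.

Lemma comp_snd_continuous (f : K -> R) :
  continuous f -> continuous (fun p : H * K => f p.2).
Proof. by move=> fc p; apply: continuous_comp; [exact: cvg_snd|exact: fc]. Qed.

Lemma adjoint_pairing_closed (q : K * H) :
  closed [set p : H * K | inner p.2 q.1 = inner p.1 q.2].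
Proof.
rewrite (_ : [set _ | _] =
    (fun p : H * K => inner p.2 q.1 - inner p.1 q.2) @^-1` [set 0 : R]).
  apply: (continuous_closedP _).1; last exact: closed_eq.
  move=> p; apply: cvgB.
    exact: (comp_snd_continuous (@inner_continuousl _ _ _)).
  exact: (comp_fst_continuous (@inner_continuousl _ _ _)).
by apply/seteqP; split => p /= => [->|/eqP]; rewrite ?subrr// subr_eq0 => /eqP.
Qed.

Lemma adjoint_closure A : adjoint (closure A) = adjoint A.
Proof.
apply/seteqP; split=> q /= Aq x y Axy; first exact/Aq/subset_closure.
apply: (@adjoint_pairing_closed q (x, y)); apply: closureS Axy => -[u v] /=.
exact: Aq.
Qed.

Lemma adjoint_lspan (X : set (H * K)) (q : K * H) :
  (forall p, X p -> inner p.2 q.1 = inner p.1 q.2) -> adjoint (lspan X) q.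
Proof.
pose M := [set p : H * K | inner p.2 q.1 = inner p.1 q.2].
move=> Xq x y; apply: (@lspan_sub _ _ X M _ Xq (x, y)).
split=> [|a u v /= uq vq]; first by rewrite /M /= !inner0l.
by rewrite /M /= !innerDl !innerZl uq vq.
Qed.

Lemma op_dom_linear_subspace A : linear_subspace A -> linear_subspace (op_dom A).
Proof.
move=> [A0 Al]; split=> [|a u v [y Au] [z Av]]; first by exists 0.
by exists (a *: y + z); exact: (Al a (u, y) (v, z)).
Qed.

(** Two values of the closure at the same point have the same inner product
    with every vector in the domain of the adjoint. *)
Lemma closable_of_total_adjoint A : total_set (op_dom (adjoint A)) -> closable A.
Proof.
rewrite -(adjoint_closure A) => tot x y z Axy Axz.
apply/eqP; rewrite -subr_eq0; apply/eqP/tot => w [u Awu].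
by rewrite innerC innerBl (Awu _ _ Axy) (Awu _ _ Axz) subrr.
Qed.

Lemma adjoint_linear_subspace A : linear_subspace (adjoint A).
Proof.
split=> [|a q r Aq Ar] x y Axy; first by rewrite !inner0r.
by rewrite !innerDr !innerZr (Aq _ _ Axy) (Ar _ _ Axy).
Qed.

Lemma comp_op_linear_subspace A :
  linear_subspace A -> linear_subspace (comp_op (adjoint A) A).
Proof.
move=> [A0 Al]; have [B0 Bl] := adjoint_linear_subspace A.
split=> [|a [x z] [x' z'] /= [y Ay By] [y' Ay' By']]; first by exists 0.
exists (a *: y + y'); first exact: (Al a (x, y) (x', y')).
exact: (Bl a (y, z) (y', z')).
Qed.

(** The operator [1 + A^* A] is onto. Minimising over the graph of [A] gives a
    point [(x, y)] of the graph with [<x, z> + <y, w> = <h, z>] for every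
    [(z, w)] in the graph, which says exactly that [A^* y = h - x]. *)
Lemma comp_op_adjoint_surj A h : closed A -> linear_subspace A ->
  exists x z, comp_op (adjoint A) A (x, z) /\ h = x + z.
Proof.
move=> Acl Alin.
pose b (p q : H * K) := inner p.1 q.1 + inner p.2 q.2.
pose phi (p : H * K) := inner h p.1.
have [[x y] Axy xyP] : exists2 p, A p & forall q, A q -> b p q = phi q.
  apply: (@sym_lax_milgram _ _ _ _ _ `|h|) => //.
  - by move=> F; exact: complete_pair_cvg.
  - by move=> u v; rewrite /b innerC (innerC u.2).
  - by move=> a u v w; rewrite /b !innerDl !innerZl; ring.
  - move=> u; rewrite /b !inner_norm prod_normE /Num.max.
    by case: ifP => _; rewrite ?lerDl ?lerDr exprn_ge0.
  - move=> p; apply: cvgD.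
      exact: (comp_fst_continuous (@inner_sqr_continuous _ _)).
    exact: (comp_snd_continuous (@inner_sqr_continuous _ _)).
  - by move=> a u v; rewrite /phi innerDr innerZr.
  - move=> u; apply: le_trans (cauchy_schwarz _ _) _; apply: ler_wpM2l => //.
    by rewrite prod_normE le_max lexx.
exists x, (h - x); split; last by rewrite addrC subrK.
exists y => //= z w Azw; have := xyP _ Azw; rewrite /b /phi /= innerBr.
rewrite (innerC z x) (innerC z h) (innerC w y); lra.
Qed.

End Adjoint.

Lemma adjoint_closed (R : realType) (H K : hilbertType R) (A : set (H * K)) :
  closed (adjoint A).
Proof.
move=> q Aq x y Axy.
have : [set r : K * H | inner r.2 x = inner r.1 y] q.
  apply: (@adjoint_pairing_closed _ _ _ (x, y)); apply: closureS Aq => r Ar /=.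
  by rewrite innerC -(Ar _ _ Axy) innerC.
by move=> /= qxy; rewrite innerC -qxy innerC.
Qed.

(** [C = A^* A] is symmetric and [1 + C] is onto. For [(p, q)] in the graph of
    [C^*], surjectivity gives [(x, z)] in the graph of [C] with
    [p + q = x + z]; then [d = p - x] satisfies [C^* d = - d], so it is
    orthogonal to the range of [1 + C] and [d = 0]. Hence [C^*] is contained in
    [C]. The domain is dense: write a vector [d] orthogonal to it as
    [d = x + C x]; then [|x|^2 + |A x|^2 = <x, d> = 0], so [d = A^* 0 = 0]. *)
Theorem von_neumann (R : realType) (H K : hilbertType R) (A : set (H * K)) :
  closed A -> linear_subspace A -> total_set (op_dom A) ->
  self_adjoint (comp_op (adjoint A) A).
Proof.
move=> Acl Alin Atot; set C := comp_op _ _.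
have sym p q : C p -> C q -> inner p.2 q.1 = inner p.1 q.2.
  move=> [y Apy Byp] [z Aqz Bzq].
  by rewrite innerC -(Byp _ _ Aqz) innerC -(Bzq _ _ Apy).
have Clin : linear_subspace C by exact: comp_op_linear_subspace.
split.
  apply: total_linear_dense; first exact: op_dom_linear_subspace.
  move=> d dC; have [x [z [Cxz dE]]] := comp_op_adjoint_surj d Acl Alin.
  have := dC x (ex_intro _ z Cxz); move: Cxz => [/= y Axy Byz].
  rewrite dE innerDr -(Byz _ _ Axy) !inner_norm => xy0.
  have x0 : x = 0.
    apply: inner_eq0; rewrite inner_norm.
    by have := sqr_ge0 `|x|; have := sqr_ge0 `|y|; lra.
  have y0 : y = 0.
    apply: inner_eq0; rewrite inner_norm.
    by have := sqr_ge0 `|x|; have := sqr_ge0 `|y|; lra.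
  rewrite x0 add0r; apply: Atot => u [v Auv].
  by rewrite -(Byz _ _ Auv) y0 inner0r.
apply/seteqP; split=> [[p q] Cpq|q Cq x z Cxz]; last exact: (sym (x, z)).
have [x [z [Cxz pqE]]] := comp_op_adjoint_surj (p + q) Acl Alin.
have qE : q - z = - (p - x).
  by apply/eqP; rewrite -addr_eq0 addrACA -opprD [q + p]addrC pqE addrC
    [z + x]addrC addNr.
have px : p = x.
  apply/eqP; rewrite -subr_eq0; apply/eqP/inner_eq0.
  have [u [w [Cuw dE]]] := comp_op_adjoint_surj (p - x) Acl Alin.
  have := Cpq _ _ Cuw; have := sym _ _ Cuw Cxz; rewrite /= => Ew Ep.
  rewrite [X in inner X _]dE innerDl.
  rewrite [inner w _]innerBr Ew Ep -innerBr qE.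
  by rewrite -[- (p - x)]sub0r (innerBr u 0) inner0r; ring.
have qz : q = z by apply/eqP; rewrite -subr_eq0 qE px subrr oppr0.
by rewrite px qz.
Qed.

(** A self-adjoint graph is an adjoint, hence closed, so it is enough to contain
    the operator before closure. *)
Lemma self_adjoint_extension_adjoint_comp (R : realType) (H K : hilbertType R)
    (A : set (H * K)) (L : set (H * H)) :
  linear_subspace A -> total_set (op_dom A) ->
  L `<=` comp_op (adjoint A) (closure A) ->
  self_adjoint_extension (comp_op (adjoint A) (closure A)) (closure L).
Proof.
move=> Alin Atot LC.
have sa : self_adjoint (comp_op (adjoint A) (closure A)).
  rewrite -(adjoint_closure A); apply: von_neumann.
  - exact: closed_closure.
  - exact: closure_linear_subspace.
  - move=> d dA; apply: Atot => x [y Axy]; apply: dA.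
    by exists y; exact: subset_closure.
split=> //; case: sa => _ saE; rewrite -[X in _ `<=` X]saE.
apply: subset_trans (@adjoint_closed _ _ _ _).
by rewrite saE; exact: closureS.
Qed.

(** * Sums of finitely supported families *)

Lemma rsum_fsupp (R : realType) (I : choiceType) (f : I -> R) (X : set I) :
  finite_set X -> (forall i, ~ X i -> f i = 0) ->
  rsum f = \sum_(i \in X) f i.
Proof.
move=> fX f0.
have E (g : I -> R) : (forall i, 0 <= g i) -> (forall i, ~ X i -> g i = 0) ->
    (\esum_(i in [set: I]) (g i)%:E = (\sum_(i \in X) g i)%:E)%E.
  move=> g0 gX; rewrite -fsumEFin// -esum_fset//; last first.
    by move=> i _; rewrite lee_fin.
  rewrite [RHS]esum_mkcond; apply: eq_esum => i _.
  by case: ifPn => // /negP; rewrite inE => /gX ->.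
rewrite /rsum.
rewrite (_ : (EFin \o f)^\+%E = fun i => (Num.max (f i) 0)%:E); last first.
  by apply/funext => i; rewrite funeposE /= EFin_max.
rewrite (_ : (EFin \o f)^\-%E = fun i => (Num.max (- f i) 0)%:E); last first.
  by apply/funext => i; rewrite funenegE /= EFin_max.
rewrite !E; try by move=> i; rewrite le_max lexx orbT.
- rewrite -EFinB /= !fsbig_finite//= -sumrB; apply: eq_bigr => i _.
  by case: (leP (f i) 0) => ?; case: (leP (- f i) 0) => ?; lra.
- by move=> i /f0 ->; rewrite oppr0 maxxx.
- by move=> i /f0 ->; rewrite maxxx.
Qed.

Lemma summable_fsupp (R : realType) (I : choiceType) (f : I -> R) (X : set I) :
  finite_set X -> (forall i, ~ X i -> f i = 0) ->
  summable [set: I] (EFin \o f).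
Proof.
move=> fX f0; rewrite /summable.
have -> : (\esum_(i in [set: I]) `|(EFin \o f) i| = \esum_(i in X) `|f i|%:E)%E.
  rewrite [RHS]esum_mkcond; apply: eq_esum => i _ /=.
  by case: ifPn => // /negP; rewrite inE => /f0 ->; rewrite normr0.
by rewrite esum_fset// fsumEFin// ltry.
Qed.

Lemma rsum_image (R : realType) (I J : choiceType) (h : I -> J) (f : J -> R)
    (X : set I) :
  finite_set X -> injective h -> (forall j, ~ (h @` X) j -> f j = 0) ->
  rsum f = \sum_(i \in X) f (h i).
Proof.
move=> fX hI f0; rewrite (rsum_fsupp (finite_image _ fX) f0).
apply: reindex_fsbig; split=> [i Xi|i j _ _|j [i Xi <-]]; first by exists i.
  exact: hI.
by exists i.
Qed.

(** * Dipoles and the Laplacian of a network *)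

Section Network.
Context {R : realType} {V : countType} (N : network R V) (o : V).

Lemma conductance_eq0 x y : ~~ adj N x y -> conductance N x y = 0.
Proof.
rewrite -conductance_gt0 -leNgt => c0.
by apply/eqP; rewrite eq_le c0 conductance_ge0.
Qed.

Lemma inner_delta_l2 (x : V) (f : l2 R V) : inner (delta_l2 x) f = f x.
Proof.
rewrite inner_l2E (@rsum_fsupp _ _ _ [set x]).
- by rewrite fsbig_set1 /= /kronecker eqxx mul1r.
- exact: finite_set1.
- by move=> y /eqP/negPf yx; rewrite /= /kronecker yx mul0r.
Qed.

(** Discrete Green formula for a point mass. Each edge at [x] occurs twice in
    the energy sum, once in each orientation; the two halves are [g] and its
    reflection [g'], which cancels the factor 1/2. *)
Lemma inner_delta_energy x (u : energy_space N) :
  inner (delta_energy N x) u = laplacian N (energy_repr u) x.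
Proof.
pose X := [set y | adj N x y].
have fX : finite_set X by exact: adj_finite.
pose g (p : V * V) :=
  kronecker R x p.1 * (conductance N p.1 p.2 * incr u p.1 p.2).
pose g' (p : V * V) := g (p.2, p.1).
have suppg p : ~ ((fun y => (x, y)) @` X) p -> g p = 0.
  case: p => y z /= yzX; rewrite /g /kronecker /=.
  have [yx|] := eqVneq y x; last by rewrite mul0r.
  have /conductance_eq0 -> : ~~ adj N y z.
    by apply/negP => yz; apply: yzX; exists z; rewrite /X /= -yx.
  by rewrite mul0r mulr0.
have suppg' p : ~ ((fun y => (y, x)) @` X) p -> g' p = 0.
  case: p => y z yzX; apply: suppg => -[w Xw [xz wy]].
  by apply: yzX; exists w => //=; rewrite xz wy.
rewrite inner_energyE /energy.
rewrite (_ : (fun p => _) = g \+ g'); last first.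
  apply/funext => -[y z] /=.
  have /= := incr_energy_class (EnergyFun (kronecker_energy N x)) y z.
  rewrite {1}/incr => ->.
  by rewrite /g' /g /= (conductance_sym N z y) /incr; ring.
rewrite rsumD; [|exact: summable_fsupp (finite_image _ fX) suppg
                |exact: summable_fsupp (finite_image _ fX) suppg'].
rewrite (rsum_image fX _ suppg); last by move=> ? ? [].
rewrite (rsum_image fX _ suppg'); last by move=> ? ? [].
rewrite /g' /g /= /kronecker eqxx /laplacian.
under eq_fsbigr do rewrite mul1r.
have half (s : R) : 2^-1 * (s + s) = s by lra.
by rewrite half.
Qed.

(** Along one edge the increment is controlled by the corresponding term of the
    energy; a path joining the two vertices gives the general case. *)
Lemma incr_bounded x y :
  exists C, forall u : energy_space N, `|incr u x y| <= C * `|u|.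
Proof.
have [p [+ <-]] := adj_connected N x y.
elim: p x => [|z p IH] x /=.
  by exists 0 => u; rewrite /incr subrr normr0 mul0r.
move=> /andP[xz /IH [C uC]].
have s0 : 0 < Num.sqrt 2^-1 :> R by rewrite sqrtr_gt0 invr_gt0.
have c0 : 0 < Num.sqrt (conductance N x z) by rewrite sqrtr_gt0 conductance_gt0.
exists ((Num.sqrt (conductance N x z))^-1 * (Num.sqrt 2^-1)^-1 + C) => u.
have -> : incr u x (last z p) = incr u x z + incr u z (last z p).
  by rewrite /incr; ring.
rewrite mulrDl; apply: le_trans (ler_normD _ _) _; apply: lerD => //.
rewrite energy_norm -mulrA mulKf ?gt_eqF// mulrC ler_pdivlMr//.
have := l2_coord_le (grad_class u) (x, z).
by rewrite grad_classE /= normrM (gtr0_norm c0) mulrC.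
Qed.

Lemma dipoleP x (u : energy_space N) : inner (dipole N o x) u = incr u x o.
Proof.
have [C uC] := incr_bounded x o.
have [v vP] : exists v : energy_space N, forall u, inner v u = incr u x o.
  by apply: riesz uC => a v w; rewrite incrD incrZ.
pose D := [set v : energy_space N | forall u, inner v u = incr u x o].
exact: (@xgetPex _ 0 D (ex_intro _ v vP)).
Qed.

(** The identity that makes [T] and [S] formally adjoint to each other:
    [<v_x, T delta_y> = <S v_x, delta_y>]. *)
Lemma inner_dipole_delta x y :
  inner (dipole N o x) (delta_energy N y) =
  inner (delta_l2 x - delta_l2 o) (delta_l2 y).
Proof.
by rewrite dipoleP incr_energy_class innerBl !inner_delta_l2.
Qed.

Lemma laplacian_eq (f g : V -> R) : (forall x y, f x - f y = g x - g y) ->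
  laplacian N f = laplacian N g.
Proof.
by move=> fg; apply/funext => x; apply: eq_fsbigr => y _; rewrite fg.
Qed.

Lemma opT_incr f w : opT N (f, w) -> forall x y, incr w x y = f x - f y.
Proof.
pose M := [set p : l2 R V * energy_space N |
  forall x y, incr p.2 x y = p.1 x - p.1 y].
apply: (@lspan_sub _ _ _ M) => [|_ [x _ <-] y z]; last by rewrite incr_energy_class.
split=> [x y|a u v uM vM x y] /=.
  by rewrite -[0](scale0r 0) incrZ mul0r subrr.
rewrite incrD incrZ uM vM.
by rewrite -[RHS]/(a * u.1 x + v.1 x - (a * u.1 y + v.1 y)); ring.
Qed.

(** By the Green formula, [(Delta v_x)(y) = <delta_y, v_x> = (S v_x)(y)]; both
    sides are linear in the dipole. *)
Lemma opS_laplacian v f :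
  opS N o (v, f) -> (f : V -> R) = laplacian N (energy_repr v).
Proof.
move=> vf; apply/funext => y; rewrite -inner_delta_energy -inner_delta_l2.
move: vf; pose M := [set p : energy_space N * l2 R V |
  inner (delta_l2 y) p.2 = inner (delta_energy N y) p.1].
apply: (@lspan_sub _ _ _ M); last first.
  by move=> _ [x _ <-]; rewrite /M /= innerC -inner_dipole_delta innerC.
split=> [|a u w /= uM wM]; first by rewrite /M /= !inner0r.
by rewrite /M /= !innerDr !innerZr uM wM.
Qed.

Lemma total_delta_l2 (X : set (l2 R V)) :
  (forall x : V, X (delta_l2 x)) -> total_set X.
Proof.
move=> Xd f fX; apply/val_inj/funext => x.
by rewrite -[LHS]/(f x) -inner_delta_l2; exact: fX.
Qed.

Lemma total_dipole (X : set (energy_space N)) :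
  (forall x, X (dipole N o x)) -> total_set X.
Proof.
move=> Xd u uX; apply: incr_inj => x y.
have E z : incr u z o = 0 by rewrite -dipoleP; exact: uX.
have -> : incr u x y = incr u x o - incr u y o by rewrite /incr; ring.
by rewrite !E subrr -[0 in RHS](scale0r 0) incrZ mul0r.
Qed.

Lemma adjoint_opT_dipole x :
  adjoint (opT N) (dipole N o x, delta_l2 x - delta_l2 o).
Proof.
apply: adjoint_lspan => _ [y _ <-] /=.
by rewrite innerC inner_dipole_delta innerC.
Qed.

Lemma adjoint_opS_delta x : adjoint (opS N o) (delta_l2 x, delta_energy N x).
Proof. by apply: adjoint_lspan => _ [y _ <-] /=; rewrite -inner_dipole_delta. Qed.

End Network.

(** * The self-adjoint extensions *)

Theorem theorem4p4 (R : realType) (V : countType) (N : network R V) (o : V) :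
  let T := opT N in
  let S := opS N o in
  (closable T /\
   self_adjoint_extension (comp_op (adjoint T) (closure T)) (laplacian_l2 N)) /\
  (closable S /\
   self_adjoint_extension (comp_op (adjoint S) (closure S))
     (laplacian_energy N o)).
Proof.
move=> T S.
have domT x : op_dom T (delta_l2 x).
  by exists (delta_energy N x); apply: sub_lspan; exists x.
have domS x : op_dom S (dipole N o x).
  by exists (delta_l2 x - delta_l2 o); apply: sub_lspan; exists x.
have domT' x : op_dom (adjoint T) (dipole N o x).
  by exists (delta_l2 x - delta_l2 o); exact: adjoint_opT_dipole.
have domS' x : op_dom (adjoint S) (delta_l2 x).
  by exists (delta_energy N x); exact: adjoint_opS_delta.
split; split.
- exact/closable_of_total_adjoint/total_dipole.
- apply: self_adjoint_extension_adjoint_comp; first exact: lspan_linear_subspace.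
    exact: total_delta_l2.
  move=> [p q] /= [/(op_dom_lspan (delta_energy N))[w Tpw] qE].
  exists w; first exact: subset_closure.
  apply: adjoint_lspan => _ [y _ <-] /=.
  rewrite inner_delta_energy inner_delta_l2 qE.
  by congr (_ y); apply: laplacian_eq => x z; exact: (opT_incr Tpw).
- exact/closable_of_total_adjoint/total_delta_l2.
- apply: self_adjoint_extension_adjoint_comp; first exact: lspan_linear_subspace.
    exact: total_dipole.
  move=> [p q] /= [].
  move=> /(op_dom_lspan (fun x => delta_l2 x - delta_l2 o))[f Spf] [w -> wE].
  exists f; first exact: subset_closure.
  apply: adjoint_lspan => _ [y _ <-] /=.
  rewrite dipoleP incr_energy_class wE -(opS_laplacian Spf).
  by rewrite innerBl !inner_delta_l2.
Qed.
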